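(* Let $\mathcal{T}=(V^I,E^I)$ be an ingredient tree with $V^I=\{I_1,\dots,I_N\}$ and root ingredient $\mathcal{R}$, and let $\mathcal{G}^E=(V^E,E^E)$ be an element graph based on $\mathcal{T}$, where $w_j$ is the weight of vertex $j$ and $v_{i,j}$ is the weight of the edge between two connected elements $i$ and $j$. Associate with each ingredient $I_i$, having $L_i$ elements, a vector $\mathbf{d}_{I_i}$ of size $L_i$, whose entry $\mathbf{d}_{I_i}[j]$, for an element $j\in I_i$, denotes the maximum value of the subtree rooted at the element vertex $j$. Then the optimal solution (the value of the optimal creative) equals $\max_{j\in\mathcal{R}}\mathbf{d}_{\mathcal{R}}[j]$, and the state transition equation for dynamic programming is $$\mathbf{d}_{I_i}[j]=\begin{cases} w_j, & \text{if } I_i\in\mathcal{L},\\ w_j+\sum_{I_m\in\mathcal{C}[I_i]}\ \max_{t\in I_m}\bigl(v_{j,t}+\mathbf{d}_{I_m}[t]\bigr), & \text{otherwise,}\end{cases}$$ where $\mathcal{L}$ is the set of leaf ingredients of $\mathcal{T}$ and $\mathcal{C}[I_i]$ is the set of child ingredients of $I_i$ in $\mathcal{T}$. The dynamic programming algorithm that evaluates this recursion (recursively from the root, computing the vectors of all child ingredients before that of their parent) and returns $\max_{j\in\mathcal{R}}\mathbf{d}_{\mathcal{R}}[j]$ has time complexity $\mathcal{O}(|V^E|+|E^E|)$.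
   Context: An ingredient is a collection of elements (for example, the possible text colors used in compositing an advertising creative). An ingredient tree $\mathcal{T}=(V^I,E^I)$ is a rooted tree whose vertex set $V^I=\{I_1,\dots,I_N\}$ is the set of $N$ ingredients and whose edges represent relationships between ingredients. The element graph based on $\mathcal{T}$ is the graph $\mathcal{G}^E=(V^E,E^E)$ obtained by substituting each ingredient with its elements: $V^E=I_1\cup\cdots\cup I_N$ is the set of elements of the $N$ ingredients, and $E^E$ is the set of edges, indicating the matching level between elements of two ingredients connected in $\mathcal{T}$; there is no connection between two elements of the same ingredient. Visual constraints are incorporated by removing connections between certain elements, indicating the 0-level of matching between them. A feasible candidate creative $\mathbf{c}$ is constructed by selecting an element in each ingredient; it corresponds to a connected subgraph $\mathcal{G}^E_{\mathbf{c}}=(V^E_{\mathbf{c}},E^E_{\mathbf{c}})$ of $\mathcal{G}^E$ that is isomorphic to $\mathcal{T}$. Its estimated click-through rate is $b+\sum_{j\in V^E_{\mathbf{c}}}w_j+\sum_{(i,j)\in E^E_{\mathbf{c}}}v_{i,j}$, where $b$ is a bias term not depending on $\mathbf{c}$. The optimal creative is a feasible candidate creative with the largest estimated click-through rate; its value in the claim is the sum of its vertex and edge weights, i.e. its estimated click-through rate without the constant $b$. *)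

(* Defs.v *)
From HB Require Import structures.
From mathcomp Require Import all_boot all_order all_algebra.
From mathcomp Require Import boolp reals constructive_ereal.

Set Implicit Arguments.
Unset Strict Implicit.
Unset Printing Implicit Defensive.

Import Order.TTheory GRing.Theory Num.Theory.
Local Open Scope ring_scope.

(** * Finite simple graphs

    A graph with vertices in a finite type is a vertex set together with a set
    of edges, an edge being a two-element set of vertices. *)

Section Graphs.
Variable V : finType.

Definition graph : Type := ({set V} * {set {set V}})%type.

Definition adj (F : {set {set V}}) : rel V := fun x y => [set x; y] \in F.

Definition simple_edges (F : {set {set V}}) : Prop :=
  forall e, e \in F -> #|e| = 2%N.

Definition subgraph (H : graph) (F : {set {set V}}) : Prop :=
  H.2 \subset F /\ (forall e, e \in H.2 -> e \subset H.1).

Definition connected (H : graph) : Prop :=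
  {in H.1 &, forall x y, connect (adj H.2) x y}.

Definition induced (F : {set {set V}}) (S : {set V}) : graph :=
  (S, [set e in F | e \subset S]).

Definition simple_path (F : {set {set V}}) (x y : V) (p : seq V) : Prop :=
  [/\ path (adj F) x p, uniq (x :: p) & last x p = y].

(** A tree: any two vertices are joined by exactly one simple path. *)
Definition is_tree (F : {set {set V}}) : Prop :=
  simple_edges F /\ forall x y, exists! p, simple_path F x y p.

End Graphs.

Definition isomorphic (V W : finType) (H : graph V) (K : graph W) : Prop :=
  exists f : V -> W,
    [/\ {in H.1 &, injective f},
        f @: H.1 = K.1 &
        {in H.1 &, forall x y, adj H.2 x y = adj K.2 (f x) (f y)}].

(** * Ingredient trees and element graphs *)

Record ingredient_tree (I : finType) := IngredientTree {
  tedges : {set {set I}};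
  troot : I;
  tedges_tree : is_tree tedges }.

Section IngredientTree.
Variables (I : finType) (T : ingredient_tree I).

(** The vertices [k] whose path from the root goes through [i]. *)
Definition subtree (i : I) : {set I} :=
  [set k | `[< exists2 p, simple_path (tedges T) (troot T) k p
                        & i \in troot T :: p >]].

Definition children (i : I) : {set I} :=
  [set m | adj (tedges T) i m && (m \in subtree i)].

Definition leaves : {set I} := [set i | children i == set0].

(** [E] is the disjoint union of the ingredients, each of them nonempty, and
    [owner j] is the ingredient containing [j].  Not all pairs of elements of
    adjacent ingredients need be connected: the missing edges are those removed
    by the visual constraints.  As the edges of the tree have two distinct
    ends, no edge joins two elements of the same ingredient. *)
Record element_graph (E : finType) := ElementGraph {
  owner : E -> I;
  gedges : {set {set E}};
  owner_surj : forall i, exists j, owner j = i;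
  gedges_based : forall e, e \in gedges ->
    exists j t, e = [set j; t] /\ adj (tedges T) (owner j) (owner t) }.

Section Creatives.
Variables (E : finType) (G : element_graph E).

Definition ingredient (i : I) : {set E} := [set j | owner G j == i].

(** One element in each ingredient of [S], and no other element. *)
Definition selects (S : {set I}) (X : {set E}) : Prop :=
  (forall j, j \in X -> owner G j \in S) /\
  (forall i, i \in S -> #|X :&: ingredient i| = 1%N).

Definition creative_on (S : {set I}) (c : graph E) : Prop :=
  [/\ selects S c.1, subgraph c (gedges G), connected c
    & isomorphic c (induced (tedges T) S)].

Definition feasible (c : graph E) : Prop := creative_on [set: I] c.

Variables (R : realType) (w : E -> R) (v : {set E} -> R).

(** [v [set i; j]] is the weight of the edge between [i] and [j]. *)
Definition value (c : graph E) : R :=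
  \sum_(j in c.1) w j + \sum_(e in c.2) v e.

Definition ctr (b : R) (c : graph E) : R :=
  b + \sum_(j in c.1) w j + \sum_(e in c.2) v e.

Definition optimal (b : R) (c : graph E) : Prop :=
  feasible c /\ forall c', feasible c' -> ctr b c' <= ctr b c.

(** The entry at [j] of the vector of [i]: the largest value of a selection of
    elements for the subtree rooted at [i] that selects [j] in [i].  It is [-oo]
    if the removed edges leave no such selection. *)
Definition dvec (i : I) (j : E) : \bar R :=
  \big[maxe/-oo%E]_(c : graph E | `[< creative_on (subtree i) c >]
                                  && (j \in c.1)) (value c)%:E.

End Creatives.
End IngredientTree.

(** * The dynamic programming algorithm

    The algorithm is a program for a unit-cost machine: the input and the
    memory are accessible only through the instructions below, each of which
    costs 1.  Programs are polymorphic in the types of ingredients, elements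
    and values, so that they cannot compute on these otherwise.  The memory
    consists of an array [d] indexed by elements, which holds the vectors of
    all ingredients, and a work array [best] indexed by ingredients. *)

Inductive instr (In El Val : Type) : Type -> Type :=
| Step : instr In El Val unit       (* a loop test or a function call *)
| Root : instr In El Val In
| Children : In -> instr In El Val (seq In)
| Elements : In -> instr In El Val (seq El)
| Neighbours : El -> instr In El Val (seq (El * Val))
                     (* adjacency list, each entry with the edge weight *)
| Owner : El -> instr In El Val In
| IsChild : In -> In -> instr In El Val bool
                     (* is the first argument the parent of the second *)
| Weight : El -> instr In El Val Val
| NegInf : instr In El Val Val
| IsNegInf : Val -> instr In El Val bool
| Add : Val -> Val -> instr In El Val Val
| Max : Val -> Val -> instr In El Val Val
| GetD : El -> instr In El Val Val
| SetD : El -> Val -> instr In El Val unit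
| GetBest : In -> instr In El Val Val
| SetBest : In -> Val -> instr In El Val unit.

Arguments Step {In El Val}.
Arguments Root {In El Val}.
Arguments Children {In El Val}.
Arguments Elements {In El Val}.
Arguments Neighbours {In El Val}.
Arguments Owner {In El Val}.
Arguments IsChild {In El Val}.
Arguments Weight {In El Val}.
Arguments NegInf {In El Val}.
Arguments IsNegInf {In El Val}.
Arguments Add {In El Val}.
Arguments Max {In El Val}.
Arguments GetD {In El Val}.
Arguments SetD {In El Val}.
Arguments GetBest {In El Val}.
Arguments SetBest {In El Val}.

Inductive prog (In El Val A : Type) : Type :=
| Ret : A -> prog In El Val A
| Do : forall B : Type, instr In El Val B -> (B -> prog In El Val A) ->
       prog In El Val A.

Arguments Ret {In El Val A}.
Arguments Do {In El Val A B}.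

Fixpoint bind (In El Val A B : Type) (p : prog In El Val A)
    (k : A -> prog In El Val B) : prog In El Val B :=
  match p with
  | Ret a => k a
  | Do _ o h => Do o (fun x => bind (h x) k)
  end.

Declare Scope prog_scope.
Delimit Scope prog_scope with prog.
Notation "x <~ o ;; p" := (Do o (fun x => p))
  (at level 61, o at next level, right associativity) : prog_scope.
Notation "o ;~ p" := (Do o (fun _ => p))
  (at level 61, right associativity) : prog_scope.
Notation "p ;> q" := (bind p (fun _ => q))
  (at level 61, right associativity) : prog_scope.

Section Algorithm.
Variables (In El Val : Type).
Local Notation prog := (prog In El Val).
Local Open Scope prog_scope.

Fixpoint foreach (A : Type) (s : seq A) (body : A -> prog unit) : prog unit :=
  match s with
  | [::] => Step ;~ Ret tt
  | a :: s' => Step ;~ body a ;> foreach s' body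
  end.

(** [best] at the ingredient of [t] is raised to [v_(j,t) + d[t]]. *)
Definition relax (i : In) (n : El * Val) : prog unit :=
  m <~ Owner n.1 ;; c <~ IsChild i m ;;
  if c then
    x <~ GetD n.1 ;; y <~ Add n.2 x ;; z <~ GetBest m ;; u <~ Max z y ;;
    SetBest m u ;~ Ret tt
  else Ret tt.

Definition reset (n : El * Val) : prog unit :=
  m <~ Owner n.1 ;; x <~ NegInf ;; SetBest m x ;~ Ret tt.

(** Adds up [best] over the children, stopping at the first [-oo]: an element
    then costs no more than its degree, up to a constant factor, even if it has
    no neighbour in most of the child ingredients. *)
Fixpoint gather (ms : seq In) (acc : Val) : prog Val :=
  match ms with
  | [::] => Step ;~ Ret acc
  | m :: ms' =>
      Step ;~ x <~ GetBest m ;; e <~ IsNegInf x ;;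
      if e then Ret x else acc' <~ Add acc x ;; gather ms' acc'
  end.

(** [best] is [-oo] at all children of [i] before and after the call. *)
Definition entry (i : In) (j : El) : prog unit :=
  ns <~ Neighbours j ;;
  foreach ns (relax i) ;>
  a <~ Weight j ;;
  ms <~ Children i ;;
  bind (gather ms a) (fun x => SetD j x ;~ foreach ns reset).

(** The recursion depth is bounded by [n]. *)
Fixpoint solve (n : nat) (i : In) : prog unit :=
  match n with
  | 0%N => Ret tt
  | n'.+1 =>
      Step ;~ x <~ NegInf ;; SetBest i x ;~
      ms <~ Children i ;; foreach ms (solve n') ;>
      es <~ Elements i ;; foreach es (entry i)
  end.

Fixpoint maximum (es : seq El) (acc : Val) : prog Val :=
  match es with
  | [::] => Step ;~ Ret acc
  | j :: es' =>
      Step ;~ x <~ GetD j ;; acc' <~ Max acc x ;; maximum es' acc'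
  end.

Definition dynprog (n : nat) : prog Val :=
  r <~ Root ;; solve n r ;> es <~ Elements r ;; x <~ NegInf ;; maximum es x.

End Algorithm.

Section Semantics.
Variables (I : finType) (T : ingredient_tree I).
Variables (E : finType) (G : element_graph T E).
Variables (R : realType) (w : E -> R) (v : {set E} -> R).

(** The input lists children, elements and neighbours in arbitrary order. *)
Record layout := Layout {
  kids : I -> seq I;
  elts : I -> seq E;
  nbrs : E -> seq E;
  kidsP : forall i, perm_eq (kids i) (enum (children T i));
  eltsP : forall i, perm_eq (elts i) (enum (ingredient G i));
  nbrsP : forall j, perm_eq (nbrs j) (enum [set t | adj (gedges G) j t]) }.

Record memory := Memory { mem_d : E -> \bar R; mem_best : I -> \bar R }.

Variable L : layout.

Definition exec (B : Type) (o : instr I E (\bar R) B) (s : memory) :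
    B * memory :=
  match o in instr _ _ _ B return (B * memory)%type with
  | Step => (tt, s)
  | Root => (troot T, s)
  | Children i => (kids L i, s)
  | Elements i => (elts L i, s)
  | Neighbours j => ([seq (t, (v [set j; t])%:E) | t <- nbrs L j], s)
  | Owner j => (owner G j, s)
  | IsChild i m => (m \in children T i, s)
  | Weight j => ((w j)%:E, s)
  | NegInf => (-oo%E, s)
  | IsNegInf x => (x == -oo%E, s)
  | Add x y => ((x + y)%E, s)
  | Max x y => (maxe x y, s)
  | GetD j => (mem_d s j, s)
  | SetD j x => (tt, Memory [eta mem_d s with j |-> x] (mem_best s))
  | GetBest m => (mem_best s m, s)
  | SetBest m x => (tt, Memory (mem_d s) [eta mem_best s with m |-> x])
  end.

(** Result, final memory, and number of instructions executed. *)
Fixpoint run (A : Type) (p : prog I E (\bar R) A) (s : memory) :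
    A * memory * nat :=
  match p with
  | Ret a => (a, s, 0%N)
  | Do _ o k =>
      let: (x, s1) := exec o s in
      let: (a, s2, n) := run (k x) s1 in (a, s2, n.+1)
  end.

End Semantics.

(* Main.v *)
Require Import Defs.
From HB Require Import structures.
From mathcomp Require Import all_boot all_order all_algebra.
From mathcomp Require Import boolp reals constructive_ereal.
From mathcomp Require Import zify.

Set Implicit Arguments.
Unset Strict Implicit.
Unset Printing Implicit Defensive.

Import Order.TTheory GRing.Theory Num.Theory.
Local Open Scope ring_scope.

(** By uniqueness of paths, the subtree of [i] consists of the [k] such that
    the path from the root to [i] is a prefix of the path to [k]; it is
    therefore the disjoint union of [i] and of the subtrees of its children.
    A creative on a subtree is the image of a selector [x : I -> E], one element
    per ingredient, that sends the edges of the subtree to edges of the element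
    graph; its value is a sum over the nodes of the subtree, which splits along
    the same union.  This gives the recurrence.  The algorithm is analysed with
    Hoare triples that also bound the time: processing one element costs
    [O(1 + degree)], since the sum over the children stops at the first [-oo]
    and so reads, but for one, only children that contain a neighbour; the
    degrees add up to at most twice the number of edges. *)

(** * Edges as unordered pairs of vertices *)

Lemma adjC (V : finType) (F : {set {set V}}) : symmetric (adj F).
Proof. by move=> x y; rewrite /adj setUC. Qed.

Lemma adj_neq (V : finType) (F : {set {set V}}) (x y : V) :
  simple_edges F -> adj F x y -> x != y.
Proof.
by move=> sF /sF; apply: contra_eq_neq => ->; rewrite setUid cards1.
Qed.

Lemma set2_inj (V : finType) (a b c d : V) :
  [set a; b] = [set c; d] -> a = c /\ b = d \/ a = d /\ b = c.
Proof.
move=> eqS.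
have: a \in [set c; d] by rewrite -eqS !inE eqxx.
have: b \in [set c; d] by rewrite -eqS !inE eqxx orbT.
have: c \in [set a; b] by rewrite eqS !inE eqxx.
have: d \in [set a; b] by rewrite eqS !inE eqxx orbT.
rewrite !inE => /orP[]/eqP-> /orP[]/eqP-> /orP[]/eqP h1 /orP[]/eqP h2; subst;
  by [left | right].
Qed.

(** * Rooted trees *)

Section RootedTree.
Variables (I : finType) (T : ingredient_tree I).
Local Notation root := (troot T).
Local Notation adjT := (adj (tedges T)).

(** The path leaves out its starting vertex, so it is empty at the root and [k] is its last entry
    elsewhere. Subtrees and children become prefix relations between these sequences. *)
Definition rpath (k : I) : seq I := sval (cid ((tedges_tree T).2 root k)).

Lemma rpathP k : simple_path (tedges T) root k (rpath k).
Proof. by rewrite /rpath; case: cid => p []. Qed.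

Lemma rpath_unique k p : simple_path (tedges T) root k p -> rpath k = p.
Proof. by rewrite /rpath; case: cid => q /= [_]; apply. Qed.

Lemma last_rpath k : last root (rpath k) = k.
Proof. by have [] := rpathP k. Qed.

Lemma rpath_inj : injective rpath.
Proof. by move=> a b eab; rewrite -(last_rpath a) eab last_rpath. Qed.

(** An initial piece of a simple path is simple, so by uniqueness it is the path to its own
    endpoint. *)
Lemma rpath_catl k p q : rpath k = p ++ q -> rpath (last root p) = p.
Proof.
move=> ek; have [] := rpathP k; rewrite ek cat_path -cat_cons cat_uniq.
by move=> /andP[pp _] /andP[up _] _; apply: rpath_unique.
Qed.

Lemma mem_rpath i k : (i \in root :: rpath k) = prefix (rpath i) (rpath k).
Proof.
apply/idP/prefixP => [ik|[q ->]]; last first.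
  by rewrite -cat_cons mem_cat -{1}(last_rpath i) mem_last.
case/splitPl: {2}(rpath k) / ik (erefl (rpath k)) => p q lp ek.
by exists q; rewrite ek -lp (rpath_catl ek).
Qed.

Lemma in_subtree i k : (k \in subtree T i) = prefix (rpath i) (rpath k).
Proof.
rewrite inE -mem_rpath; apply/asboolP/idP => [[p /rpath_unique <-]//|ik].
by exists (rpath k) => //; apply: rpathP.
Qed.

(** If one end of the edge is off the path to the other, appending it gives a simple path. Were each
    end on the path to the other, the two paths would be prefixes of each other, hence equal, and so
    would be the ends. *)
Lemma adj_rpath a b :
  adjT a b -> rpath b = rcons (rpath a) b \/ rpath a = rcons (rpath b) a.
Proof.
have ext x y : adjT x y -> y \notin root :: rpath x ->
    rpath y = rcons (rpath x) y.
  move=> xy ny; apply: rpath_unique; have [px ux lx] := rpathP x.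
  split; first by rewrite rcons_path px lx.
    by rewrite -rcons_cons rcons_uniq ny.
  by rewrite last_rcons.
move=> ab; have nab := adj_neq (tedges_tree T).1 ab.
have [bPa|/(ext _ _ ab)] := boolP (b \in root :: rpath a); last by left.
right; apply: ext; first by rewrite adjC.
apply/negP; rewrite mem_rpath; move: bPa; rewrite mem_rpath.
case/prefixP => q ea /prefixP[q' eb].
have : size (q' ++ q) = 0%N.
  apply/eqP; rewrite -(eqn_add2l (size (rpath a))) addn0 -size_cat.
  by rewrite catA -eb -ea.
case: q' eb => // eb _; rewrite cats0 in eb.
by move/rpath_inj: eb nab => ->; rewrite eqxx.
Qed.

Lemma in_children i m : (m \in children T i) = (rpath m == rcons (rpath i) m).
Proof.
rewrite inE in_subtree; apply/andP/eqP => [[/adj_rpath[//|ei] /prefixP[q em]]|em].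
  by move/(congr1 size): ei; rewrite em size_rcons size_cat => /eqP;
     rewrite -addSn -{1}[size _]addn0 addSnnS eqn_add2l.
split; last by rewrite em prefix_rcons.
by have [] := rpathP m; rewrite em rcons_path last_rpath => /andP[].
Qed.

Lemma adj_children a b :
  adjT a b = (b \in children T a) || (a \in children T b).
Proof.
apply/idP/orP => [/adj_rpath[]/eqP|]; rewrite -?in_children; try by [left|right].
by case; rewrite inE => /andP[]; rewrite // adjC.
Qed.

Lemma children_asym a b : b \in children T a -> a \notin children T b.
Proof.
rewrite !in_children => /eqP eb; apply/eqP => /(congr1 size).
by rewrite eb !size_rcons => /eqP; rewrite -addn2 -{1}[size _]addn0 eqn_add2l.
Qed.

Lemma mem_subtree i : i \in subtree T i.
Proof. by rewrite in_subtree prefix_refl. Qed.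

Lemma subtree_root : subtree T root = [set: I].
Proof.
apply/setP => k; rewrite in_subtree inE.
by rewrite (@rpath_unique root [::]) ?prefix0s.
Qed.

Lemma subtree_trans i k : k \in subtree T i -> subtree T k \subset subtree T i.
Proof.
rewrite in_subtree => ik; apply/subsetP => l; rewrite !in_subtree.
exact: prefix_trans.
Qed.

Lemma children_subtree i m : m \in children T i -> m \in subtree T i.
Proof. by rewrite inE => /andP[]. Qed.

(** The child of [i] whose subtree contains [k]. *)
Definition branch (i k : I) : I := nth i (rpath k) (size (rpath i)).

(** The path to [k] properly extends the path to [i], and the next entry on it is the child
    sought. *)
Lemma branchP i k : k \in subtree T i -> k != i ->
  (branch i k \in children T i) && (k \in subtree T (branch i k)).
Proof.
rewrite !in_subtree in_children => /prefixP[[|m q] ek nki].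
  by rewrite cats0 in ek; rewrite (rpath_inj ek) eqxx in nki.
have em : rpath m = rcons (rpath i) m.
  by rewrite -cat_rcons in ek; have := rpath_catl ek; rewrite last_rcons.
rewrite /branch ek nth_cat ltnn subnn /= em eqxx /=.
by rewrite -cat_rcons prefix_prefix.
Qed.

Lemma branch_child i m k :
  m \in children T i -> k \in subtree T m -> branch i k = m.
Proof.
rewrite in_children in_subtree => /eqP em /prefixP[q ek].
by rewrite /branch ek em cat_rcons nth_cat ltnn subnn.
Qed.

Lemma notin_subtree_child i m : m \in children T i -> i \notin subtree T m.
Proof.
rewrite in_children in_subtree => /eqP em; apply/negP => /prefixP[q].
rewrite em => /(congr1 size) /eqP; rewrite size_cat size_rcons.
by rewrite -{1}[size _]addn0 addSnnS eqn_add2l.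
Qed.

Lemma subtree_child i m : m \in children T i -> subtree T m \subset subtree T i.
Proof. by move/children_subtree/subtree_trans. Qed.

Lemma card_subtree_child i m :
  m \in children T i -> (#|subtree T m| < #|subtree T i|)%N.
Proof.
move=> mi; apply/proper_card/properP; split; first exact: subtree_child.
by exists i; rewrite ?mem_subtree ?notin_subtree_child.
Qed.

(** The nodes below [i] are grouped by [branch i]. A general operation is allowed because the lemma
    serves both for weights in [R] and for costs in [nat]. *)
Lemma big_subtree (A : Type) (idx : A) (op : Monoid.com_law idx) (F : I -> A) i :
  \big[op/idx]_(k in subtree T i) F k =
  op (F i) (\big[op/idx]_(m in children T i)
              \big[op/idx]_(k in subtree T m) F k).
Proof.
rewrite (bigD1 i) ?mem_subtree //=; congr (op _ _).
rewrite (partition_big (branch i) (mem (children T i))) /=; last first.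
  by move=> k /andP[ki nki]; case/andP: (branchP ki nki).
apply: eq_bigr => m mi; apply: eq_bigl => k.
apply/andP/idP => [[/andP[ki nki] /eqP<-]|km].
  by case/andP: (branchP ki nki).
split; last by rewrite (branch_child mi km).
rewrite (subsetP (subtree_child mi)) //=.
by apply: contraNneq (notin_subtree_child mi) => <-.
Qed.

(** Induction down the tree, obtained by removing the last entry of the part of the path that leads
    from [i] to [k]. *)
Lemma subtree_ind i (Q : I -> Prop) :
  Q i -> (forall a b, a \in subtree T i -> b \in children T a -> Q a -> Q b) ->
  forall k, k \in subtree T i -> Q k.
Proof.
move=> Qi Qch k; rewrite in_subtree => /prefixP[q].
elim/last_ind: q k => [|q x IH] k.
  by rewrite cats0 => /rpath_inj->.
rewrite -rcons_cat => ek.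
have xk : x = k by rewrite -(last_rpath k) ek last_rcons.
have ea : rpath (last root (rpath i ++ q)) = rpath i ++ q.
  by apply: (@rpath_catl k _ [:: x]); rewrite cats1.
apply: Qch (IH _ ea); first by rewrite in_subtree ea prefix_prefix.
by rewrite in_children ea ek xk.
Qed.

End RootedTree.

(** * Creatives as selectors *)

Section Selections.
Variables (I : finType) (T : ingredient_tree I).
Variables (E : finType) (G : element_graph T E).
Local Notation adjT := (adj (tedges T)).
Local Notation adjG := (adj (gedges G)).

Lemma adj_owner j t : adjG j t -> adjT (owner G j) (owner G t).
Proof.
move=> /gedges_based[a [b [/set2_inj[] [-> ->] ab]]] //.
by rewrite adjC.
Qed.

(** A section of [owner] on all ingredients, hence injective. Only its values on the subtree at hand
    matter, which avoids partial functions. *)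
Definition selector (x : I -> E) : Prop := cancel x (owner G).

Definition compatible (i : I) (x : I -> E) : Prop :=
  forall a b, a \in subtree T i -> b \in children T a -> adjG (x a) (x b).

Definition creative_of (i : I) (x : I -> E) : graph E :=
  induced (gedges G) (x @: subtree T i).

Lemma mem_creative_of i x k : selector x ->
  (x k \in (creative_of i x).1) = (k \in subtree T i).
Proof. by move=> /can_inj xI; rewrite mem_imset. Qed.

Lemma compatible_adj i x a b : compatible i x ->
  a \in subtree T i -> b \in subtree T i -> adjT a b -> adjG (x a) (x b).
Proof.
move=> xC ai bi; rewrite adj_children => /orP[/(xC _ _ ai)//|/(xC _ _ bi)].
by rewrite adjC.
Qed.

(** The isomorphism is [owner]: edges of the element graph lie over tree edges, and compatibility
    gives the converse. The graph is connected because every chosen element is reached from [x i] by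
    descending the tree. *)
Lemma creative_of_creative i x : selector x -> compatible i x ->
  creative_on G (subtree T i) (creative_of i x).
Proof.
move=> xT xC; set S := subtree T i.
have memX j : j \in x @: S -> owner G j \in S /\ j = x (owner G j).
  by case/imsetP => k kS ->; rewrite xT.
split.
- split=> [j /memX[]//|k kS]; apply/eqP/cards1P; exists (x k).
  apply/setP => j; rewrite !inE; apply/andP/eqP => [[/memX[_ {2}->] /eqP->//]|->].
  by rewrite xT imset_f.
- split; first by apply/subsetP => e; rewrite inE => /andP[].
  by move=> e; rewrite inE => /andP[].
- have symH : connect_sym (adj (creative_of i x).2).
    by apply: sym_connect_sym => a b; rewrite adjC.
  have conn k : k \in S -> connect (adj (creative_of i x).2) (x i) (x k).
    move: k; apply: subtree_ind => [|a b aS ba ca]; first exact: connect0.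
    apply: connect_trans ca (connect1 _).
    rewrite /adj inE [_ \in gedges G](xC _ _ aS ba) subUset !sub1set.
    by rewrite !imset_f //; apply: (subsetP (subtree_trans aS)) _ (children_subtree ba).
  move=> _ _ /imsetP[a aS ->] /imsetP[b bS ->].
  by apply: (@connect_trans _ _ (x i)); [rewrite symH|]; apply: conn.
- exists (owner G); split.
  + by move=> j t /memX[_ ->] /memX[_ ->]; rewrite !xT => ->.
  + by rewrite -imset_comp (eq_imset _ xT) imset_id.
  + move=> _ _ /imsetP[a aS ->] /imsetP[b bS ->]; rewrite !xT /adj !inE.
    rewrite !subUset !sub1set !imset_f // aS bS !andbT.
    apply/idP/idP => [/adj_owner|]; first by rewrite !xT.
    exact: compatible_adj xC aS bS.
Qed.

(** An isomorphic copy of the tree has as many edges as the tree, and [owner]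
    maps its edges injectively to edges of the tree; so it misses no edge. *)
Lemma creative_edges S (c : graph E) : creative_on G S c ->
  {in c.1 &, forall j t, adjT (owner G j) (owner G t) -> [set j; t] \in c.2}.
Proof.
case=> -[cS c1] [c2G c2c] _ [f [fI /= fim fadj]].
have oI : {in c.1 &, injective (owner G)}.
  move=> j t jc tc ejt; have /eqP/cards1P[y ey] := c1 _ (cS _ jc).
  have: j \in [set y] by rewrite -ey !inE jc eqxx.
  have: t \in [set y] by rewrite -ey !inE tc ejt eqxx.
  by rewrite !inE => /eqP-> /eqP->.
have setI_inj : {in c.2 &, injective (fun e : {set E} => owner G @: e)}.
  move=> e e' ec ec' ee'; apply/setP => j; apply/idP/idP => je.
    have: owner G j \in owner G @: e' by rewrite -ee' imset_f.
    case/imsetP => t te' /oI-> //; first exact: subsetP (c2c _ ec) _ je.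
    exact: subsetP (c2c _ ec') _ te'.
  have: owner G j \in owner G @: e by rewrite ee' imset_f.
  case/imsetP => t te' /oI-> //; first exact: subsetP (c2c _ ec') _ je.
  exact: subsetP (c2c _ ec) _ te'.
set K := (induced (tedges T) S).2.
have subK : (fun e : {set E} => owner G @: e) @: c.2 \subset K.
  apply/subsetP => _ /imsetP[e ec ->].
  have [j [t [ee jt]]] := gedges_based (subsetP c2G _ ec).
  have /subsetP ecS := c2c _ ec.
  rewrite ee imsetU1 imset_set1 inE [_ \in tedges T]jt subUset !sub1set.
  by rewrite !cS ?ecS // ee !inE eqxx ?orbT.
(* The given isomorphism [f] need not agree with [owner], so it is used only for counting: each edge
   of [K] is the image under [f] of an edge of [c]. *)
have leK : (#|K| <= #|c.2|)%N.
  apply: leq_trans (leq_imset_card (fun e : {set E} => f @: e) _).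
  apply/subset_leq_card/subsetP => e; rewrite inE => /andP[eT eS].
  have /eqP/cards2P[a [b [_ ee]]] := (tedges_tree T).1 _ eT.
  move: eS; rewrite ee subUset !sub1set -fim => /andP[/imsetP[j jc ea] /imsetP[t tc eb]].
  apply/imsetP; exists [set j; t]; last by rewrite imsetU1 imset_set1 ea eb.
  have := fadj _ _ jc tc; rewrite -ea -eb /adj => ->.
  by rewrite inE -ee eT ee subUset !sub1set -fim ea eb !imset_f.
have eqK : (fun e : {set E} => owner G @: e) @: c.2 = K.
  by apply/eqP; rewrite eqEcard subK card_in_imset.
move=> j t jc tc jt.
have: [set owner G j; owner G t] \in K.
  by rewrite inE [_ \in tedges T]jt subUset !sub1set !cS.
rewrite -eqK => /imsetP[e ec ee]; suff -> : [set j; t] = e by [].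
have [j' [t' [e' _]]] := gedges_based (subsetP c2G _ ec).
have /subsetP ecS := c2c _ ec.
have j'c : j' \in c.1 by rewrite ecS // e' !inE eqxx.
have t'c : t' \in c.1 by rewrite ecS // e' !inE eqxx orbT.
move: ee; rewrite e' imsetU1 imset_set1 => /set2_inj[] [/oI-> // /oI-> //].
by rewrite setUC.
Qed.

(** Converse of [creative_of_creative]. By [creative_edges] the creative contains every edge of the
    element graph between its vertices, so its vertex set determines it. *)
Lemma creative_selector i (c : graph E) : creative_on G (subtree T i) c ->
  exists x, [/\ selector x, compatible i x & c = creative_of i x].
Proof.
set S := subtree T i => cc; have ccE := creative_edges cc.
case: cc => -[cS c1] [c2G c2c] _ _.
have ex k : exists j, owner G j = k /\ (k \in S -> c.1 :&: ingredient G k = [set j]).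
  (* Outside the subtree any element of the ingredient will do. *)
  case: (boolP (k \in S)) => kS; last first.
    by have [j jk] := owner_surj G k; exists j.
  have /eqP/cards1P[j ej] := c1 _ kS; exists j; split=> //.
  have: j \in [set j] by rewrite inE.
  by rewrite -ej !inE => /andP[_ /eqP].
have [x xP] := choice ex.
have xT : selector x by move=> k; have [] := xP k.
have xc k : k \in S -> x k \in c.1.
  move=> kS; have [_ /(_ kS) ek] := xP k.
  have: x k \in [set x k] by rewrite inE.
  by rewrite -ek !inE => /andP[].
have c1E : c.1 = x @: S.
  apply/setP => j; apply/idP/imsetP => [jc|[k kS ->]]; last exact: xc.
  exists (owner G j); first exact: cS.
  have [_ /(_ (cS _ jc)) ek] := xP (owner G j).
  by apply/eqP; rewrite -in_set1 -ek !inE jc eqxx.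
exists x; split=> //.
  move=> a b aS ba; apply: (subsetP c2G); apply: ccE.
  - exact: xc.
  - by apply/xc/(subsetP (subtree_trans aS))/children_subtree.
  - by rewrite !xT adj_children ba.
rewrite [c]surjective_pairing c1E; congr pair; apply/setP => e; rewrite inE -c1E.
apply/idP/andP => [ec|[eG ec]]; first by rewrite (subsetP c2G) ?c2c.
have [j [t [ee jt]]] := gedges_based eG.
by rewrite ee; apply: ccE => //; apply: (subsetP ec); rewrite ee !inE eqxx ?orbT.
Qed.

(** * The value of a creative as a sum over the nodes of the tree *)

Variables (R : realType) (w : E -> R) (v : {set E} -> R).

(** Each edge weight is charged to the parent end of its tree edge, which makes [big_subtree]
    applicable. *)
Definition tree_value (i : I) (x : I -> E) : R :=
  \sum_(a in subtree T i) (w (x a) + \sum_(b in children T a) v [set x a; x b]).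

Lemma value_creative_of i x : selector x -> compatible i x ->
  value w v (creative_of i x) = tree_value i x.
Proof.
move=> xT xC; have xI := can_inj xT.
rewrite /value /tree_value big_split /= big_imset /=; last by move=> ? ? _ _ /xI.
congr (_ + _).
(* [D] is the set of tree edges of the subtree, directed from parent to child; [x] maps it
   bijectively to the edges of the creative. Injectivity on unordered pairs holds since no edge is
   directed both ways. *)
pose D := [set p : I * I | (p.1 \in subtree T i) && (p.2 \in children T p.1)].
have -> : [set e in gedges G | e \subset x @: subtree T i] =
    [set [set x p.1; x p.2] | p in D].
  apply/setP => e; rewrite inE; apply/andP/imsetP => [[eG ex]|[[a b]]].
    have [j [t [ee jt]]] := gedges_based eG.
    move: ex; rewrite ee subUset !sub1set => /andP[/imsetP[a aS ea] /imsetP[b bS eb]].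
    move: jt; rewrite ea eb !xT adj_children => /orP[] h.
      by exists (a, b); rewrite // inE /= aS.
    by exists (b, a); [rewrite inE /= bS|rewrite setUC].
  rewrite inE /= => /andP[aS ba] ->; split; first exact: xC.
  rewrite subUset !sub1set !imset_f //.
  by apply/(subsetP (subtree_trans aS))/children_subtree.
rewrite big_imset /=; last first.
  have DE a b : ((a, b) \in D) = (a \in subtree T i) && (b \in children T a).
    by rewrite inE.
  move=> [a b] [a' b']; rewrite !DE /= => /andP[_ ba] /andP[_ ba'].
  case/set2_inj => -[/xI ea /xI eb]; subst => //.
  by rewrite (negbTE (children_asym ba)) in ba'.
by rewrite pair_big_dep /=; apply: eq_bigl => p; rewrite inE.
Qed.

Lemma tree_valueE i x : tree_value i x =
  w (x i) + \sum_(m in children T i) (v [set x i; x m] + tree_value m x).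
Proof. by rewrite /tree_value big_subtree /= big_split /= addrA. Qed.

Lemma compatibleE i x : compatible i x <->
  forall m, m \in children T i -> adjG (x i) (x m) /\ compatible m x.
Proof.
split=> [xC m mi|xC a b ai ba].
  split=> [|a b am ba]; first by apply: xC mi; apply: mem_subtree.
  by apply: xC ba; apply: (subsetP (subtree_child mi)).
have [eai|nai] := eqVneq a i; first by case: (xC b); rewrite -eai.
have /andP[mi am] := branchP ai nai.
by have [_] := xC _ mi; apply.
Qed.

Lemma eq_tree_value i x y : {in subtree T i, x =1 y} ->
  tree_value i x = tree_value i y.
Proof.
move=> xy; apply: eq_bigr => a ai; rewrite xy //; congr (_ + _).
apply: eq_bigr => b ba; rewrite (xy b) //.
by apply: (subsetP (subtree_trans ai)) (children_subtree ba).
Qed.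

Lemma eq_compatible i x y : {in subtree T i, x =1 y} ->
  compatible i x -> compatible i y.
Proof.
move=> xy xC a b ai ba; rewrite -!xy //; first exact: xC.
by apply: (subsetP (subtree_trans ai)) (children_subtree ba).
Qed.

Lemma dvec_ge i x : selector x -> compatible i x ->
  ((tree_value i x)%:E <= dvec G w v i (x i))%E.
Proof.
move=> xT xC; rewrite -value_creative_of //; apply: le_bigmax_cond.
by rewrite mem_creative_of // mem_subtree andbT; apply/asboolP/creative_of_creative.
Qed.

(** A finite maximum other than its default [-oo] is one of its terms, here the value of a creative,
    and that creative comes from a selector. *)
Lemma dvec_attained i j : j \in ingredient G i -> dvec G w v i j <> -oo%E ->
  exists x, [/\ selector x, compatible i x, x i = j
              & dvec G w v i j = (tree_value i x)%:E].
Proof.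
rewrite inE => /eqP ji; rewrite /dvec.
elim/big_rec: _ => // c y /andP[/asboolP cc jc] IH.
rewrite maxEle; case: ifP => // _ _.
have [x [xT xC ec]] := creative_selector cc; exists x; split=> //.
  by move: jc; rewrite ec => /imsetP[k _ ej]; rewrite -ji ej xT.
by rewrite ec value_creative_of.
Qed.

End Selections.

Lemma bigmax_attained (R : realType) (A : finType) (P : pred A) (F : A -> \bar R) :
  let M := \big[maxe/-oo%E]_(a | P a) F a in
  M <> -oo%E -> exists2 a, P a & M = F a.
Proof.
elim/big_rec: _ => //= a y Pa IH; rewrite maxEle; case: ifP => // _ _.
by exists a.
Qed.

(** * The recurrence *)

Section Recurrence.
Variables (I : finType) (T : ingredient_tree I).
Variables (E : finType) (G : element_graph T E).
Variables (R : realType) (w : E -> R) (v : {set E} -> R).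
Local Notation d := (dvec G w v).
Local Notation best_child j m :=
  (\big[maxe/-oo%E]_(t in ingredient G m | adj (gedges G) j t)
     ((v [set j; t])%:E + d m t)%E).

(** A best selection for the subtree of [i] restricts to the subtree of each child, where it
    competes in the corresponding maximum. *)
Lemma dvec_le i j : j \in ingredient G i ->
  (d i j <= (w j)%:E + \sum_(m in children T i) best_child j m)%E.
Proof.
move=> ji; have [->|/eqP] := eqVneq (d i j) -oo%E; first exact: leNye.
case/(dvec_attained ji) => x [xT /compatibleE xC xi ->].
rewrite tree_valueE EFinD -sumEFin xi; apply/leeD2l/lee_sum => m mi.
have [jm xCm] := xC _ mi; rewrite EFinD.
apply: le_trans (leeD2l _ (dvec_ge w v xT xCm)) _.
apply: (@le_bigmax_cond _ _ _ _ _ _ (fun t => (v [set j; t])%:E + d m t)%E).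
by rewrite inE xT eqxx -xi.
Qed.

(** Optimal selections for the subtrees of the children are glued along
    [branch]. *)
Lemma dvec_glue i j : j \in ingredient G i ->
  (forall m, m \in children T i -> best_child j m <> -oo%E) ->
  ((w j)%:E + \sum_(m in children T i) best_child j m <= d i j)%E.
Proof.
rewrite inE => /eqP ji finM.
(* [x0] is a filler: the choice of [X] below ranges over all ingredients, not only the children of
   [i]. *)
have [x0 x0T] := choice (owner_surj G).
have ex m : exists x : I -> E, selector G x /\ (m \in children T i ->
    [/\ compatible G m x, adj (gedges G) j (x m)
      & best_child j m = (v [set j; x m] + tree_value T w v m x)%:E]).
  have [mi|] := boolP (m \in children T i); last by exists x0.
  have [t /andP[tm jt] eM] := bigmax_attained (finM m mi).
  have dt : d m t <> -oo%E by move=> dt; apply: (finM m mi); rewrite eM dt.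
  have [x [xT xC xm ed]] := dvec_attained tm dt.
  by exists x; split=> // _; split; rewrite ?xm // eM ed.
have [X XP] := choice ex.
pose y k := if k == i then j else X (branch T i k) k.
have yT : selector G y.
  by move=> k; rewrite /y; case: eqP => [->//|_]; have [] := XP (branch T i k).
have yX m : m \in children T i -> {in subtree T m, X m =1 y}.
  move=> mi k km; rewrite /y (branch_child mi km) ifN //.
  by apply: contraTneq km => ->; apply: notin_subtree_child.
have yi : y i = j by rewrite /y eqxx.
have yC : compatible G i y.
  apply/compatibleE => m mi; have [_ /(_ mi)[XC jX _]] := XP m.
  split; last exact: eq_compatible (yX m mi) XC.
  by rewrite yi -(yX m) ?mem_subtree.
have := dvec_ge w v yT yC; rewrite yi; apply: le_trans.
rewrite tree_valueE EFinD -sumEFin yi; apply/leeD2l/lee_sum => m mi.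
have [_ /(_ mi)[_ _ ->]] := XP m.
by rewrite (eq_tree_value _ _ (yX m mi)) (yX m mi) ?mem_subtree.
Qed.

(** Gluing needs a selection below every child. If some child admits none compatible with [j], its
    term [-oo] absorbs the whole sum and the lower bound is trivial. *)
Lemma dvec_recurrence i j : j \in ingredient G i ->
  d i j = ((w j)%:E + \sum_(m in children T i) best_child j m)%E.
Proof.
move=> ji; apply/le_anti; rewrite dvec_le //=.
have [/existsP[m /andP[mi /eqP em]]|/existsPn noM] :=
    boolP [exists m in children T i, best_child j m == -oo%E].
  suff /eqP -> : (\sum_(m in children T i) best_child j m == -oo)%E by apply: leNye.
  by rewrite esum_eqNy; apply/existsP; exists m; rewrite mi em /=.
apply: dvec_glue => // m mi; apply/eqP; have := noM m.
by rewrite mi.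
Qed.

Lemma feasibleE c : feasible G c <-> creative_on G (subtree T (troot T)) c.
Proof. by rewrite /feasible subtree_root. Qed.

Lemma optimal_value b c : optimal G w v b c ->
  (value w v c)%:E =
  \big[maxe/-oo%E]_(j in ingredient G (troot T)) d (troot T) j.
Proof.
case=> fc maxc; apply/le_anti/andP; split.
  have [x [xT xC ->]] := creative_selector ((feasibleE c).1 fc).
  rewrite value_creative_of //; apply: le_trans (dvec_ge w v xT xC) _.
  by apply: le_bigmax_cond; rewrite inE xT.
apply: bigmax_le => [|j _]; first exact: leNye.
apply: bigmax_le => [|c' /andP[/asboolP/feasibleE/maxc]]; first exact: leNye.
(* The bias [b] is common to all creatives and cancels. *)
by rewrite /ctr -!addrA lerD2l lee_fin.
Qed.

Lemma no_feasible_value : (forall c, ~ feasible G c) ->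
  \big[maxe/-oo%E]_(j in ingredient G (troot T)) d (troot T) j = -oo%E.
Proof.
move=> nf; apply: big1_idem => [|j _]; first exact: maxxx.
by apply: big_pred0 => c; apply/negP => /andP[/asboolP/feasibleE/nf].
Qed.

End Recurrence.

(** * Correctness and running time *)

Section Analysis.
Variables (I : finType) (T : ingredient_tree I).
Variables (E : finType) (G : element_graph T E).
Variables (R : realType) (w : E -> R) (v : {set E} -> R) (L : layout G).
Local Notation state := (memory I E R).
Local Notation program := (prog I E (\bar R)).
Local Notation d := (dvec G w v).

(** * Hoare triples with a time bound *)

Definition triple (A : Type) (p : program A) (s : state)
    (Q : A -> state -> Prop) (n : nat) : Prop :=
  let: (a, s', t) := run w v L p s in Q a s' /\ (t <= n)%N.

Lemma triple_do (A B : Type) (o : instr I E (\bar R) B) (k : B -> program A)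
    s Q n :
  triple (k (exec w v L o s).1) (exec w v L o s).2 Q n ->
  triple (Do o k) s Q n.+1.
Proof.
by rewrite /triple /=; case: exec => x s1 /=; case: run => -[a s2] t.
Qed.

Lemma triple_weaken (A : Type) (p : program A) s (P Q : A -> state -> Prop) m n :
  triple p s P m -> (forall a s', P a s' -> Q a s') -> (m <= n)%N ->
  triple p s Q n.
Proof.
rewrite /triple; case: run => -[a s'] t [Pa tm] PQ mn.
by split; [apply: PQ | apply: leq_trans mn].
Qed.

Lemma run_bind (A B : Type) (p : program A) (k : A -> program B) s :
  run w v L (bind p k) s =
  let: (a, s1, m) := run w v L p s in
  let: (b, s2, n) := run w v L (k a) s1 in (b, s2, (m + n)%N).
Proof.
elim: p s => [a|C o h IH] s /=; first by case: run => -[].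
case: exec => x s1; rewrite IH; case: run => -[a s2] m.
by case: run => -[].
Qed.

Lemma triple_bind (A B : Type) (p : program A) (k : A -> program B) s
    (P : A -> state -> Prop) Q m n :
  triple p s P m -> (forall a s', P a s' -> triple (k a) s' Q n) ->
  triple (bind p k) s Q (m + n).
Proof.
rewrite /triple run_bind; case: run => -[a s1] t1 [Pa t1m] /(_ _ _ Pa).
by case: run => -[b s2] t2 [Qb t2n]; split=> //; apply: leq_add.
Qed.

(** [Inv xs] holds when the items [xs] have been processed. *)
Lemma triple_foreach (A : eqType) (l : seq A) (body : A -> program unit) s
    (Inv : seq A -> state -> Prop) (c : A -> nat) :
  Inv [::] s ->
  (forall xs a s', a \in l -> Inv xs s' ->
     triple (body a) s' (fun _ => Inv (rcons xs a)) (c a)) ->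
  triple (foreach l body) s (fun _ => Inv l) (\sum_(a <- l) (c a).+1).+1.
Proof.
move=> Inv0 step.
(* The induction is on the items [ys] still to come, with those processed, [xs], kept general. Each
   item pays for its loop test, and the outer successor for the final one. *)
suff: forall ys xs s', {subset ys <= l} -> Inv xs s' ->
    triple (foreach ys body) s' (fun _ => Inv (xs ++ ys))
      (\sum_(a <- ys) (c a).+1).+1.
  by move=> /(_ l [::] s); apply.
elim=> [|a ys IH] xs s' sub Ixs; apply: triple_do => /=.
  by rewrite big_nil cats0.
rewrite big_cons addSn -addnS; apply: (triple_bind (step _ _ _ _ Ixs)).
  by apply: sub; rewrite inE eqxx.
move=> _ s1 I1; rewrite -cat_rcons; apply: IH => // b bys.
by apply: sub; rewrite inE bys orbT.
Qed.

(** * The loops of the program *)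

Definition relaxed i (s : state) (ns : seq (E * \bar R)) (s' : state) : Prop :=
  mem_d s' = mem_d s /\
  forall m, mem_best s' m =
    if m \in children T i then
      maxe (mem_best s m)
           (\big[maxe/-oo%E]_(n <- ns | owner G n.1 == m) (n.2 + mem_d s n.1)%E)
    else mem_best s m.

Lemma triple_relax i (ns : seq (E * \bar R)) s :
  triple (foreach ns (relax i)) s (fun _ => relaxed i s ns) (8 * size ns).+1.
Proof.
have <- : (\sum_(n <- ns) 8 = 8 * size ns)%N.
  by rewrite big_const_seq count_predT iter_addn_0.
(* An entry costs seven instructions if it lies in a child of [i] and two otherwise; the loop test
   makes eight. *)
apply: (triple_foreach (Inv := relaxed i s) (c := fun _ => 7%N)).
  by split=> // m; rewrite big_nil maxeNy if_same.
move=> xs n s' _ [ed eb]; do 2 apply: triple_do => /=.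
case: ifPn => [ch|nch]; last first.
  split=> //; split=> // m; rewrite eb; case: ifPn => // mi.
  rewrite big_rcons /= ifN ?maxeNy //.
  by apply: contraNneq nch => ->.
do 5 apply: triple_do => /=.
split=> //; split=> //= m; case: eqP => [->|nm].
  by rewrite ch eb ch big_rcons /= eqxx ed -maxA.
rewrite eb; case: ifP => // _; rewrite big_rcons /= ifN ?maxeNy //.
by apply/eqP => /esym.
Qed.

Definition was_reset (s : state) (ns : seq (E * \bar R)) (s' : state) : Prop :=
  mem_d s' = mem_d s /\
  forall m, mem_best s' m =
    if m \in [seq owner G n.1 | n <- ns] then -oo%E else mem_best s m.

Lemma triple_reset (ns : seq (E * \bar R)) s :
  triple (foreach ns (@reset I E (\bar R))) s (fun _ => was_reset s ns)
    (4 * size ns).+1.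
Proof.
have <- : (\sum_(n <- ns) 4 = 4 * size ns)%N.
  by rewrite big_const_seq count_predT iter_addn_0.
apply: (triple_foreach (Inv := was_reset s) (c := fun _ => 3%N)) => //.
move=> xs n s' _ [ed eb]; do 3 apply: triple_do => /=.
split=> //; split=> //= m; rewrite map_rcons mem_rcons inE eb.
by case: eqP.
Qed.

(** Stopping early is sound because [-oo] absorbs sums. Each child passed costs four instructions
    and has a [best] other than [-oo]; the 3 covers the round that stops, or else the final test. *)
Lemma triple_gather (ms : seq I) acc s :
  triple (gather E ms acc) s
    (fun x s' => s' = s /\ x = (acc + \sum_(m <- ms) mem_best s m)%E)
    (4 * count (fun m => mem_best s m != -oo%E) ms + 3).
Proof.
elim: ms acc => [|m ms IH] acc /=; first by rewrite big_nil adde0.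
rewrite mulnDr big_cons.
have [em|nm] := eqVneq (mem_best s m) -oo%E.
  rewrite /= muln0 add0n addn3.
  do 3 apply: triple_do => /=; rewrite em eqxx.
  by split=> //; rewrite addNye addeNy.
rewrite muln1 -addnA !addSn; do 3 apply: triple_do => /=.
rewrite (negbTE nm); apply: triple_do => /=; rewrite add0n.
by apply: triple_weaken (IH _) _ _ => // a s' [-> ->]; rewrite addeA.
Qed.

Lemma triple_maximum (es : seq E) acc s :
  triple (maximum I es acc) s
    (fun x s' => s' = s /\ x = maxe acc (\big[maxe/-oo%E]_(j <- es) mem_d s j))
    (3 * size es).+1.
Proof.
elim: es acc => [|j es IH] acc /=; first by rewrite big_nil maxeNy.
rewrite mulnS !addSn; do 3 apply: triple_do => /=; rewrite add0n.
by apply: triple_weaken (IH _) _ _ => // a s' [-> ->]; rewrite big_cons maxA.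
Qed.

(** * Processing one element, then one subtree *)

Definition degree (j : E) : nat := #|[set t | adj (gedges G) j t]|.

Lemma size_nbrs j : size (nbrs L j) = degree j.
Proof. by rewrite (perm_size (nbrsP L j)) -cardE. Qed.

Lemma mem_kids i m : (m \in kids L i) = (m \in children T i).
Proof. by rewrite (perm_mem (kidsP L i)) mem_enum. Qed.

Lemma mem_elts i j : (j \in elts L i) = (owner G j == i).
Proof. by rewrite (perm_mem (eltsP L i)) mem_enum inE. Qed.

(** Per neighbour, relaxing costs 8, gathering at most 4 and resetting 4. The result on [best] is a
    disjunction because [reset] visits the owners of all neighbours, also the parent of [i]. *)
Lemma triple_entry i j s : owner G j = i ->
  (forall m, m \in children T i -> mem_best s m = -oo%E) ->
  (forall t, owner G t \in children T i -> mem_d s t = d (owner G t) t) ->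
  triple (entry _ i j) s
    (fun _ s' => (forall t, mem_d s' t = if t == j then d i j else mem_d s t) /\
       forall k, mem_best s' k = -oo%E \/ mem_best s' k = mem_best s k)
    (16 * degree j + 9).
Proof.
move=> ji bs ds.
pose ns := [seq (t, (v [set j; t])%:E : \bar R) | t <- nbrs L j].
have sns : size ns = degree j by rewrite size_map size_nbrs.
have nsE : [seq owner G n.1 | n <- ns] = [seq owner G t | t <- nbrs L j].
  by rewrite -map_comp.
have -> : (16 * degree j + 9 =
    ((8 * size ns).+1 + ((4 * degree j + 3) + (4 * size ns).+1.+1).+2).+1)%N.
  by rewrite sns; lia.
apply: triple_do; apply: triple_bind (triple_relax i ns s) _ => _ s1 [ed eb].
have b1 m : m \in children T i -> mem_best s1 m =
    \big[maxe/-oo%E]_(t in ingredient G m | adj (gedges G) j t)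
      ((v [set j; t])%:E + d m t)%E.
  move=> mi; rewrite eb mi bs // maxNye big_map /= (perm_big _ (nbrsP L j)) /=.
  rewrite big_enum_cond /=; under eq_bigl do rewrite inE andbC.
  under [RHS]eq_bigl do rewrite inE.
  by apply: eq_bigr => t /andP[/eqP tm _]; rewrite ds tm.
have b1N m : m \notin [seq owner G n.1 | n <- ns] ->
    mem_best s1 m = mem_best s m.
  move=> mns; rewrite eb; case: ifP => // _; rewrite big_seq_cond big_pred0 ?maxeNy //.
  by move=> n; apply: contraNF mns => /andP[nn /eqP <-]; apply: map_f.
do 2 apply: triple_do.
apply: triple_bind.
  apply: triple_weaken (triple_gather _ _ _) (fun _ _ => id) _.
  rewrite leq_add2r leq_mul2l /= -size_filter -size_nbrs -(size_map (owner G)).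
  (* The children with [best] other than [-oo] are distinct and each contains a neighbour of [j], so
     there are at most [degree j] of them. *)
  apply: uniq_leq_size => [|m].
    by rewrite filter_uniq // (perm_uniq (kidsP L i)) enum_uniq.
  rewrite mem_filter /= mem_kids -nsE => /andP[nb mi].
  by apply: contraR nb => /b1N ->; rewrite bs.
move=> _ _ [-> ->]; apply: triple_do.
apply: triple_weaken (triple_reset _ _) _ (leqnn _) => _ s2 /= [ed2 eb2].
split=> [t|k].
  rewrite ed2 ed /=; case: eqP => // _; rewrite dvec_recurrence ?inE ?ji //.
  congr (_ + _)%E; rewrite (perm_big _ (kidsP L i)) big_enum /=.
  by apply: eq_bigr.
rewrite eb2; case: ifPn => [_|kns]; [by left | right].
exact: b1N.
Qed.

(** Of the 8, seven are spent in the call itself, apart from the work on elements and child calls;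
    the eighth is the loop test in the parent that precedes the call. The root has no such test,
    hence the predecessor in [triple_solve]. *)
Definition solve_cost (k : I) : nat :=
  8 + \sum_(j in ingredient G k) (16 * degree j + 9).+1.

Lemma subtreeE i k :
  (k \in subtree T i) = (k == i) || has (fun m => k \in subtree T m) (kids L i).
Proof.
apply/idP/orP => [ki|[/eqP->|/hasP[m]]]; last 2 first.
- exact: mem_subtree.
- by rewrite mem_kids => /subtree_child/subsetP; apply.
have [->|nki] := eqVneq k i; [by left | right].
have /andP[mi km] := branchP ki nki; apply/hasP.
by exists (branch T i k); rewrite ?mem_kids.
Qed.

(** The depth bound suffices since the subtrees of children are strictly smaller. A call leaves
    [-oo] in its own entry of [best], and later calls keep an entry or set it to [-oo]; so all
    children hold [-oo] whenever [entry] is run on an element of their parent. *)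
Lemma triple_solve n i s : (#|subtree T i| <= n)%N ->
  triple (solve E (\bar R) n i) s
    (fun _ s' =>
       [/\ forall t, mem_d s' t =
             if owner G t \in subtree T i then d (owner G t) t else mem_d s t,
           forall k, mem_best s' k = -oo%E \/ mem_best s' k = mem_best s k
         & mem_best s' i = -oo%E])
    (\sum_(k in subtree T i) solve_cost k).-1.
Proof.
elim: n i s => [|n IH] i s Sn.
  by have := mem_subtree T i; rewrite (card0_eq (eqP _)) -?leqn0.
pose cost m := (\sum_(k in subtree T m) solve_cost k)%N.
have cost_gt0 m : (0 < cost m)%N by rewrite /cost big_subtree.
have -> : (cost i).-1 = ((\sum_(m <- kids L i) (cost m).-1.+1).+1 +
    (\sum_(j <- elts L i) (16 * degree j + 9).+1).+1.+1).+4%N.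
  rewrite (perm_big _ (kidsP L i)) (perm_big _ (eltsP L i)) !big_enum /=.
  rewrite (eq_bigr cost) => [|m _]; last exact: prednK.
  rewrite {1}/cost big_subtree /=.
  rewrite -[X in (_ + X)%N = _]/(\sum_(m in children T i) cost m)%N.
  lia.
do 4 apply: triple_do => /=; set s1 := Memory _ _.
apply: triple_bind.
  apply: (triple_foreach (Inv := fun xs s' =>
     [/\ forall t, mem_d s' t =
           if has (fun m => owner G t \in subtree T m) xs
           then d (owner G t) t else mem_d s t,
         forall k, mem_best s' k = -oo%E \/ mem_best s' k = mem_best s1 k
       & forall m, m \in xs -> mem_best s' m = -oo%E])); first by split=> //; right.
  move=> xs m s2; rewrite mem_kids => mi [ed eb ex].
  apply: triple_weaken (IH m s2 _) _ (leqnn _).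
    exact: leq_trans (card_subtree_child mi) Sn.
  move=> _ s3 [ed3 eb3 em3]; split=> [t|k|k].
  - by rewrite ed3 ed -cats1 has_cat /= orbF orbC; case: ifP.
  - by case: (eb3 k) => ->; [left | apply: eb].
  - rewrite mem_rcons inE => /orP[/eqP->//|/ex e2].
    by case: (eb3 k) => ->.
move=> _ s2 [ed2 eb2 ek2]; apply: triple_do => /=.
apply: triple_weaken (triple_foreach (Inv := fun xs s' =>
     (forall t, mem_d s' t = if t \in xs then d (owner G t) t else mem_d s2 t) /\
     forall k, mem_best s' k = -oo%E \/ mem_best s' k = mem_best s2 k) _ _) _
     (leqnn _).
- by split=> // k; right.
- move=> xs j s3; rewrite mem_elts => /eqP ji [ed3 eb3].
  apply: triple_weaken (triple_entry ji _ _) _ (leqnn _).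
  + by move=> m mi; case: (eb3 m) => -> //; rewrite ek2 ?mem_kids.
  + move=> t ti; rewrite ed3; case: ifP => // _; rewrite ed2.
    by rewrite ifT //; apply/hasP; exists (owner G t); rewrite ?mem_kids ?mem_subtree.
  + move=> _ s4 [ed4 eb4]; split=> [t|k].
      by rewrite ed4 ed3 mem_rcons inE; case: eqP => [->|]; rewrite ?ji.
    by case: (eb4 k) => ->; [left | apply: eb3].
- have e1 : mem_best s1 i = -oo%E by rewrite /= eqxx.
  move=> _ s3 [ed3 eb3]; split=> [t|k|].
  + by rewrite ed3 mem_elts ed2 subtreeE; case: eqP.
  + case: (eb3 k) => ->; first by left.
    case: (eb2 k) => ->; first by left.
    by rewrite /=; case: ifP; [left | right].
  + by case: (eb3 i) => -> //; case: (eb2 i) => ->.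
Qed.

(** * The total cost *)

Lemma sum_degree : (\sum_j degree j <= 2 * #|gedges G|)%N.
Proof.
(* Incidences of elements and edges are counted twice: [t] maps injectively to the edge joining it
   to [j], and every edge has at most two ends. *)
apply: (@leq_trans (\sum_j \sum_(e in gedges G) (j \in e))%N).
  apply: leq_sum => j _; rewrite -big_mkcondr sum1dep_card /degree /=.
  rewrite -(@card_in_imset _ _ (fun t => [set j; t])) => [|t t' _ _ /set2_inj[] [] //].
    apply/subset_leq_card/subsetP => _ /imsetP[t jt ->].
    by move: jt; rewrite !inE eqxx andbT.
  by move=> -> ->.
rewrite exchange_big mulnC -sum_nat_const; apply: leq_sum => e /gedges_based[j [t [-> _]]].
by rewrite -big_mkcond sum1_card cards2; case: (_ != _).
Qed.

Lemma sum_ingredient (f : E -> nat) :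
  (\sum_k \sum_(j in ingredient G k) f j = \sum_j f j)%N.
Proof.
rewrite [RHS](partition_big (owner G) predT) //=; apply: eq_bigr => k _.
by apply: eq_bigl => j; rewrite inE.
Qed.

(** Since ingredients are nonempty, the overhead per ingredient can be charged to the elements. *)
Lemma card_ingredients : (#|I| <= #|E|)%N.
Proof.
apply: leq_trans (leq_imset_card (owner G) E).
apply/subset_leq_card/subsetP => k _.
by have [j <-] := owner_surj G k; apply: imset_f.
Qed.

Lemma sum_solve_cost :
  (\sum_k solve_cost k <= 18 * #|E| + 32 * #|gedges G|)%N.
Proof.
rewrite /solve_cost big_split /= sum_ingredient.
under [X in (_ + X <= _)%N]eq_bigr do rewrite -addnS.
rewrite big_split /= -big_distrr /=.
rewrite !sum_nat_const.
apply: (@leq_trans (#|E| * 8 + (16 * (2 * #|gedges G|) + #|E| * 10))); last first.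
  by rewrite addnCA -mulnDr mulnA addnC [(#|E| * _)%N]mulnC.
rewrite leq_add ?leq_mul2r ?card_ingredients //.
by rewrite leq_add2r leq_mul2l sum_degree.
Qed.

Lemma triple_dynprog s :
  triple (dynprog I E (\bar R) #|I|) s
    (fun x s' =>
       x = \big[maxe/-oo%E]_(j in ingredient G (troot T)) d (troot T) j /\
       forall j, mem_d s' j = d (owner G j) j)
    (32 * (#|E| + #|gedges G|)).
Proof.
have T_eq := subtree_root T.
have E_gt0 : (0 < #|E|)%N.
  by apply: leq_trans card_ingredients; apply/card_gt0P; exists (troot T).
have cost_gt0 : (0 < \sum_(k in subtree T (troot T)) solve_cost k)%N.
  by rewrite big_subtree.
apply: (@triple_weaken _ _ _ _ _ ((\sum_(k in subtree T (troot T)) solve_cost k).-1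
   + (3 * #|ingredient G (troot T)|).+1.+2).+1); last first.
(* The final maximum adds at most three per element, and the additive constants are absorbed because
   there is at least one element. *)
- have arith c e f g : (0 < c -> c <= 18 * e + 32 * f -> g <= e -> 0 < e ->
      (c.-1 + (3 * g).+1.+2).+1 <= 32 * (e + f))%N by lia.
  apply: arith => //; last exact: max_card.
  rewrite T_eq; under eq_bigl do rewrite inE.
  exact: sum_solve_cost.
- by move=> a s'; apply.
apply: triple_do => /=; apply: triple_bind.
  by apply: triple_solve; apply: max_card.
move=> _ s1 [ed _ _]; do 2 apply: triple_do => /=.
rewrite cardE -(perm_size (eltsP L (troot T))).
apply: triple_weaken (triple_maximum _ _ _) _ (leqnn _) => x s2 [-> ->].
have ed1 t : mem_d s1 t = d (owner G t) t by rewrite ed T_eq inE.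
split=> //; rewrite maxNye (perm_big _ (eltsP L (troot T))) big_enum /=.
by apply: eq_bigr => j; rewrite inE ed1 => /eqP->.
Qed.

End Analysis.

Theorem mainTheorem2 (R : realType) :
  (forall (I : finType) (T : ingredient_tree I)
          (E : finType) (G : element_graph T E)
          (w : E -> R) (v : {set E} -> R) (b : R),
     let d := dvec G w v in
     let best := \big[maxe/-oo%E]_(j in ingredient G (troot T)) d (troot T) j in
     [/\ forall c, optimal G w v b c -> (value w v c)%:E = best,
         (forall c, ~ feasible G c) -> best = -oo%E
       & forall i j, j \in ingredient G i ->
           d i j =
             if i \in leaves T then (w j)%:E
             else ((w j)%:E + \sum_(m in children T i)
                     \big[maxe/-oo]_(t in ingredient G m | adj (gedges G) j t)
                        ((v [set j; t])%:E + d m t))%E])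
  /\
  (exists C : nat,
     forall (I : finType) (T : ingredient_tree I)
            (E : finType) (G : element_graph T E)
            (w : E -> R) (v : {set E} -> R)
            (L : layout G) (s : memory I E R),
     let d := dvec G w v in
     let: (x, s', time) :=
       run w v L (dynprog I E (\bar R) #|I|) s in
     [/\ x = \big[maxe/-oo%E]_(j in ingredient G (troot T)) d (troot T) j,
         forall j, mem_d s' j = d (owner G j) j
       & (time <= C * (#|E| + #|gedges G|))%N]).
Proof.
split=> [I T E G w v b d best|].
  split=> [c|nf|i j ji]; [exact: optimal_value | exact: no_feasible_value |].
  (* The leaf case is the general formula with an empty sum. *)
  rewrite /d dvec_recurrence //; case: ifP => //; rewrite inE => /eqP->.
  by rewrite big_set0 adde0.
exists 32%N => I T E G w v L s d; have := triple_dynprog w v L s.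
by rewrite /triple; case: run => -[x s'] t [[]].
Qed.
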